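(* Let $d\ge 1$ be an integer, $a>0$, $\lambda>0$ and $0<\epsilon<a/4$. Let $\omega$ be a Poisson point process on the torus $\mathbb{T}_a^d$ with intensity measure $\lambda\,dx$, let $N_1$ be its number of points and let $\chi$ be the Euler characteristic of the Čech complex $\mathcal{C}_\epsilon(\omega)$. Then for every integer $n\ge 0$, $$\mathbf{E}[\chi\mid N_1=n]=\sum_{k=0}^{n}(-1)^{k+1}\binom{n}{k}k^d\left(\frac{2\epsilon}{a}\right)^{d(k-1)}.$$ (This is the expectation of $\chi$ for a binomial point process with $n$ points.)
   Context: $\mathbb{T}_a^d=\mathbb{R}^d/a\mathbb{Z}^d$, identified with $X=[0,a)^d$, is equipped with Lebesgue measure and the distance $\rho_d(x,y)=\inf_{m\in\mathbb{Z}^d}\|x-y+ma\|_\infty$. For a finite set $\omega\subset\mathbb{T}_a^d$, the Čech complex $\mathcal{C}_\epsilon(\omega)$ is the abstract simplicial complex with vertex set $\omega$ in which distinct points $v_0,\dots,v_k\in\omega$ form a $k$-simplex if and only if $\bigcap_{i=0}^k B(v_i,\epsilon)\neq\emptyset$, where $B(v,\epsilon)=\{y:\rho_d(v,y)<\epsilon\}$. The Euler characteristic is $\chi(\omega)=\sum_{i\ge 0}(-1)^i s_i(\omega)$, where $s_i(\omega)$ is the number of $i$-simplices (equivalently, the alternating sum of the Betti numbers). A Poisson point process with intensity measure $\lambda\,dx$ is a random finite set $\omega$ such that the number of points in any Borel set $A$ is Poisson with mean $\lambda|A|$, with independence over disjoint sets; conditionally on $N_1=n$, $\omega$ consists of $n$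 independent uniformly distributed points on the torus. *)

(* Defs.v *)
(* MathComp-Analysis, over an abstract real type R. *)
From HB Require Import structures.
From mathcomp Require Export all_boot all_order all_algebra finmap.
From mathcomp Require Export all_classical all_reals all_analysis.

Set Implicit Arguments.
Unset Strict Implicit.
Unset Printing Implicit Defensive.

Import Order.TTheory GRing.Theory Num.Theory numFieldNormedType.Exports.

Local Open Scope fset_scope.
Local Open Scope classical_set_scope.
Local Open Scope ring_scope.

(* R^d, with the product of the Borel sigma-algebras (the library instance on
   tuples), i.e. its Borel sigma-algebra. *)
Notation Rd R d := (d.-tuple (measurableTypeR R)).

Section torus.
Context {R : realType}.

(* The torus R^d / a Z^d is identified with [0, a)^d: its points are elements
   of R^d and its Borel sets are the measurable subsets of [torus d a]. *)
Definition torus (d : nat) (a : R) : set (Rd R d) :=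
  [set x | forall i : 'I_d, 0 <= tnth x i < a].

(* The norm of a row vector is the sup norm. *)
Definition torus_dist (d : nat) (a : R) (x y : Rd R d) : R :=
  inf [set r | exists m : 'I_d -> int,
    r = `| (\row_(i < d) (tnth x i - tnth y i + (m i)%:~R * a) : 'rV[R]_d) |].

Definition torus_ball (d : nat) (a : R) (v : Rd R d) (eps : R) : set (Rd R d) :=
  [set y | torus a y /\ torus_dist a v y < eps].

(* d-dimensional Lebesgue measure, as the d-fold product of the Lebesgue
   measure on R: a point mass on R^0, and on R^(d+1) the image of
   lebesgue_measure \x volume d under (x, t) |-> x :: t. *)
Fixpoint volume (d : nat) : set (Rd R d) -> \bar R :=
  match d with
  | 0 => \d_([tuple] : Rd R 0)
  | d'.+1 => pushforward (@lebesgue_measure R \x @volume d')%E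
      (fun p : measurableTypeR R * Rd R d' => [tuple of p.1 :: p.2] : Rd R d'.+1)
  end.

End torus.

Section cech.
Context {R : realType} {d : nat} (a eps : R).

Definition cech_complex (w : {fset Rd R d}) : {fset {fset Rd R d}} :=
  [fset s in fpowerset w | (s != fset0) &&
     `[< \bigcap_(v in [set` s]) torus_ball a v eps !=set0 >]].

Definition nb_simplices (w : {fset Rd R d}) (i : nat) : nat :=
  #|` [fset s in cech_complex w | #|` s| == i.+1] |.

(* There is no i-simplex for i >= #|` w|, so the sum over all i is finite. *)
Definition cech_euler (w : {fset Rd R d}) : int :=
  \sum_(i < #|` w|) (-1) ^+ i * (nb_simplices w i)%:Z.

End cech.

Section probability.
Context {R : realType} {disp : measure_display} {Omega : measurableType disp}.
Variable P : probability Omega R.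

(* The product rule over subfamilies is the case B i = setT for the omitted
   indices. *)
Definition mutually_independent {disp' : measure_display}
    {T : measurableType disp'} {I : finType} (X : I -> Omega -> T) : Prop :=
  forall B : I -> set T, (forall i, measurable (B i)) ->
    P (\bigcap_i (X i @^-1` B i)) = (\prod_i P (X i @^-1` B i))%E.

(* E[X | A] = E[X; A] / P(A), for an event A of positive probability. *)
Definition cond_expectation (X : Omega -> R) (A : set Omega) : \bar R :=
  ((fine (P A))^-1%:E * \int[P]_(w in A) (X w)%:E)%E.

Definition nb_points {d : nat} (w : {fset Rd R d}) (A : set (Rd R d)) : nat :=
  #|` [fset x in w | x \in A] |.

(* [poisson_prob r k] does not depend on its argument k; for r = 0 it is the
   point mass at 0. *)
Record poisson_process (d : nat) (a lambda : R)
    (omega : Omega -> {fset Rd R d}) : Prop := PoissonProcess {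
  poisson_process_torus : forall w x, x \in omega w -> torus a x ;
  poisson_process_measurable : forall A : set (Rd R d),
    measurable A -> A `<=` torus a ->
    measurable_fun setT (fun w => nb_points (omega w) A) ;
  poisson_process_law : forall (A : set (Rd R d)) (U : set nat),
    measurable A -> A `<=` torus a ->
    P [set w | U (nb_points (omega w) A)] =
      poisson_prob (lambda * fine (volume A)) 0 U ;
  poisson_process_independent : forall (m : nat) (A : 'I_m -> set (Rd R d)),
    (forall i, measurable (A i)) -> (forall i, A i `<=` torus a) ->
    trivIset setT A ->
    mutually_independent (fun (i : 'I_m) w => nb_points (omega w) (A i)) }.

Record iid_uniform (d : nat) (a : R) (n : nat)
    (xi : 'I_n -> Omega -> Rd R d) : Prop := IidUniform {
  iid_uniform_torus : forall i w, torus a (xi i w) ;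
  iid_uniform_measurable : forall i, measurable_fun setT (xi i) ;
  iid_uniform_law : forall i (A : set (Rd R d)),
    measurable A -> A `<=` torus a ->
    P (xi i @^-1` A) = (volume A * ((a ^+ d)^-1)%:E)%E ;
  iid_uniform_independent : mutually_independent xi }.

End probability.

(* Main.v *)
(** The Euler characteristic of the Čech complex of points [v i] is the sum over
    non-empty index sets [S] of [(-1) ^ (#|S| + 1)] times the indicator that the
    balls around the [v i], [i] in [S], have a common point; this holds even if
    the points are not distinct. Balls are cubes, so they meet iff in each
    coordinate the points lie in an open arc of length [2 * eps] of the circle.

    Cut each coordinate circle into [M] cells. As [M] grows, the indicator is
    eventually that of the event "in each coordinate the cells lie in an arc of
    [L] consecutive cells", with [L / M] tending to [2 * eps / a]. Given [n]
    points, their cells are uniformly distributed: directly for i.i.d. points,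
    and for a Poisson process because its cell counts are then multinomial and
    the discrete Euler characteristic does not depend on the labelling of the
    points. As [2 * L <= M], exactly [M * (L ^ k - (L - 1) ^ k)] of the [M ^ k]
    configurations of [k] cells lie in an arc of [L] cells (choose the first
    occupied cell), a proportion that tends to [k * (2 * eps / a) ^ (k - 1)].
    Dominated convergence concludes. *)
Require Import Defs.
From mathcomp Require Import fingroup perm finmap classical_sets measurable_realfun.
From mathcomp Require Import ring lra zify.

Set Implicit Arguments.
Unset Strict Implicit.
Unset Printing Implicit Defensive.

Import Order.TTheory GRing.Theory Num.Theory numFieldNormedType.Exports.
Local Open Scope fset_scope.
Local Open Scope classical_set_scope.
Local Open Scope ring_scope.

(** * Alternating sums over subsets *)

Section alternating_sums.
Local Open Scope fset_scope.
Local Open Scope ring_scope.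
Context {R : pzRingType}.

(** Removing [x] matches the subsets that contain it with the subsets of [J] and flips the sign. *)
Lemma alt_sum_setU1 (I : finType) (x : I) (J : {set I}) (F : {set I} -> R) :
  x \notin J ->
  \sum_(S in powerset (x |: J)%SET) (-1) ^+ #|S| * F S =
  \sum_(S in powerset J) (-1) ^+ #|S| * F S -
  \sum_(S in powerset J) (-1) ^+ #|S| * F (x |: S)%SET.
Proof.
move=> xJ; rewrite (bigID (fun S : {set I} => x \in S)) /= [LHS]addrC;
  congr (_ + _).
  apply: eq_bigl => S; rewrite !powersetE -finset.subDset.
  apply/andP/idP => [[SJ xS]|SJ]; last first.
    by split; [exact: fintype.subset_trans (finset.subsetDl _ _) SJ|
      apply: contra xJ => /(fintype.subsetP SJ)].
  by rewrite (finset.setDidPl _) // disjoint_sym disjoints1 in SJ.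
rewrite -sumrN (reindex_onto (fun S => x |: S)%SET (fun S => S :\ x)%SET) /=;
  last first.
  by move=> S /andP[_ xS]; rewrite finset.setD1K.
apply: eq_big => [S|S].
  rewrite !powersetE setU11 andbT; apply/andP/idP => [[SJ /eqP SE]|SJ].
    by rewrite -SE finset.subDset.
  rewrite setU1K ?eqxx ?finset.setUS //.
  by apply: contra xJ => /(fintype.subsetP SJ).
move=> /andP[_ /eqP SE]; rewrite cardsU1 -SE !inE eqxx /= SE.
by rewrite exprS mulN1r mulNr.
Qed.

(** When [x] already lies in [W], the last sum vanishes, since sets that differ only in [x] cancel;
    the identity thus also covers repeated values. *)
Lemma alt_sum_fsetU1 (T : choiceType) (x : T) (W : {fset T}) (F : {fset T} -> R) :
  \sum_(S <- fpowerset (x |` W)) (-1) ^+ #|` S| * F S =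
  \sum_(S <- fpowerset W) (-1) ^+ #|` S| * F S -
  \sum_(S <- fpowerset W) (-1) ^+ #|` S| * F (x |` S).
Proof.
have ins V (G : {fset T} -> R) : x \notin V ->
    \sum_(S <- fpowerset (x |` V)) (-1) ^+ #|` S| * G S =
    \sum_(S <- fpowerset V) (-1) ^+ #|` S| * G S -
    \sum_(S <- fpowerset V) (-1) ^+ #|` S| * G (x |` S).
  move=> xV; rewrite (big_fsetID _ (fun S : {fset T} => x \in S)) /= [LHS]addrC.
  have xS (S : {fset T}) : S `<=` V -> x \notin S.
    by move=> SV; apply: contra xV => /(fsubsetP SV).
  congr (_ + _).
    apply: eq_fbigl => S; rewrite !inE !fpowersetE.
    apply/andP/idP => [[SV xS']|SV].
      by rewrite -(mem_fsetD1 xS') fsubDset.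
    by rewrite xS // (fsubset_trans SV) // fsubsetU1.
  rewrite -sumrN.
  have -> : [fset S in fpowerset (x |` V) | x \in S] =
      [fset x |` S | S in fpowerset V].
    apply/fsetP => S; rewrite !inE fpowersetE.
    apply/andP/imfsetP => [[SV xS']|[S' /=]].
      by exists (S `\ x); rewrite ?fsetD1K //= fpowersetE fsubDset.
    by rewrite fpowersetE => SV ->; rewrite fsetUS // fset1U1.
  rewrite big_imfset /=.
    rewrite !big_seq; apply: eq_bigr => S; rewrite fpowersetE => /xS xS'.
    by rewrite cardfsU1 xS' exprS mulN1r mulNr.
  move=> S S' /=; rewrite !fpowersetE => /xS xS1 /xS xS2 eS.
  by rewrite -(fsetU1K xS1) eS fsetU1K.
have [xW|/ins->//] := boolP (x \in W).
rewrite mem_fset1U //.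
suff -> : \sum_(S <- fpowerset W) (-1) ^+ #|` S| * F (x |` S) = 0 by rewrite subr0.
rewrite -(fsetD1K xW) ins ?fsetD11 //.
by under [X in _ - X]eq_bigr do rewrite fsetUA fsetUid; rewrite subrr.
Qed.

(* Repeated values of [v] do not matter: the subsets of a fibre contribute
   alternating signs that cancel down to a single point. *)
Lemma alt_sum_image (I : finType) (T : choiceType) (v : I -> T)
    (F : {fset T} -> R) :
  \sum_(S <- fpowerset [fset v i | i in I]) (-1) ^+ #|` S| * F S =
  \sum_(S : {set I}) (-1) ^+ #|S| * F [fset v i | i in S].
Proof.
have -> : \sum_(S : {set I}) (-1) ^+ #|S| * F [fset v i | i in S] =
    \sum_(S in powerset [set: I]%SET) (-1) ^+ #|S| * F [fset v i | i in S].
  by apply: eq_bigl => S; rewrite powersetE finset.subsetT.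
have -> : [fset v i | i in I] = [fset v i | i in [set: I]%SET].
  by apply: eq_imfset => // i; rewrite /= !inE.
move: [set: I]%SET => J; move: F.
have [m] := ubnP #|J|; elim: m J => // m IH J Jm F.
have [->|[x xJ]] := set_0Vmem J.
  rewrite powerset0 big_set1 cards0.
  have E : [fset v i | i in finset.set0] = fset0.
    by apply/fsetP => y; rewrite in_fset0; apply/imfsetP => -[i /=]; rewrite inE.
  by rewrite E fpowerset0 big_seq_fset1 cardfs0.
have insv (S : {set I}) : [fset v i | i in (x |: S)%SET] = v x |` [fset v i | i
  in S].
  apply/fsetP => y; rewrite in_fset1U; apply/imfsetP/orP => [[i /=]|].
    rewrite !inE => /orP[/eqP ->|iS] ->; first by left.
    by right; apply/imfsetP; exists i.
  move=> [/eqP->|/imfsetP[i /= iS ->]]; last by exists i; rewrite //= !inE iS orbT.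
  by exists x; rewrite //= !inE eqxx.
have lt : (#|J :\ x| < m)%N by rewrite -ltnS (leq_trans _ Jm) // (cardsD1 x J) xJ.
rewrite -(finset.setD1K xJ) insv alt_sum_fsetU1 alt_sum_setU1;
  last by rewrite !inE eqxx.
rewrite !IH //; congr (_ - _).
by under [RHS]eq_bigr do rewrite insv.
Qed.

End alternating_sums.

(** * The Euler characteristic as an alternating sum over index sets *)

Section euler.
Context {R : realType} {d : nat} (a eps : R).

Lemma cech_eulerE (w : {fset Rd R d}) :
  cech_euler a eps w = \sum_(s <- cech_complex a eps w) (-1) ^+ #|` s|.+1.
Proof.
rewrite /cech_euler.
transitivity (\sum_(i < #|` w|) \sum_(s <- cech_complex a eps w)
    (if #|` s| == i.+1 then (-1) ^+ i else 0 : int)).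
  apply: eq_bigr => i _; rewrite /nb_simplices; move: (i : nat) => j.
  rewrite card_fset_sum1 big_fset /=.
  by rewrite -natz natr_sum mulr_sumr [LHS]big_mkcond; apply: eq_bigr => s _;
    case: ifP => //; rewrite mulr1.
rewrite exchange_big /= !big_seq; apply: eq_bigr => s.
rewrite !inE fpowersetE => /andP[sw /andP[s0 _]].
(* The only index to which [s] contributes is its cardinality minus one, which is in range since [s]
   is a non-empty subset of [w]. *)
have lt : (#|` s|.-1 < #|` w|)%N.
  by rewrite prednK ?cardfs_gt0 // fsubset_leq_card.
rewrite (bigD1 (Ordinal lt)) //= prednK ?cardfs_gt0 // eqxx big1 ?addr0.
  by rewrite -{2}(prednK (_ : 0 < #|` s|)%N) ?cardfs_gt0 // !exprS mulrA mulrNN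
    mulr1 mul1r.
by move=> i; rewrite -val_eqE /= => iE; case: eqP => // es; rewrite es eqxx in iE.
Qed.

(** Applying [alt_sum_image] to the indicator of being a simplex replaces sets of points by sets of
    labels, even if labels share a point. *)
Lemma cech_euler_image (I : finType) (v : I -> Rd R d) :
  cech_euler a eps [fset v i | i in I]%fset =
  \sum_(S : {set I} | S != finset.set0) (-1) ^+ #|S|.+1 *
     (`[< \bigcap_(i in [set` S]) torus_ball a (v i) eps !=set0 >])%:R.
Proof.
pose F (s : {fset Rd R d}) : int := ((s != fset0) &&
     `[< \bigcap_(v in [set` s]) torus_ball a v eps !=set0 >])%:R.
have -> : cech_euler a eps [fset v i | i in I]%fset =
    - \sum_(s <- fpowerset [fset v i | i in I]%fset) (-1) ^+ #|` s| * F s.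
  rewrite cech_eulerE big_fset /= -sumrN [LHS]big_mkcond; apply: eq_bigr => s _.
  by rewrite /F; case: ifP; rewrite ?mulr0 ?oppr0 // mulr1 exprS mulN1r.
rewrite alt_sum_image -sumrN [RHS]big_mkcond; apply: eq_bigr => S _.
rewrite /F; have -> : ([fset v i | i in S]%fset == fset0) = (S == finset.set0).
  apply/eqP/eqP => [E|->].
    apply/finset.setP => i; rewrite inE; apply/negP => iS.
    suff : v i \in fset0 by rewrite in_fset0.
    by rewrite -E; apply/imfsetP; exists i.
  by apply/fsetP => y; rewrite in_fset0; apply/imfsetP => -[i /=]; rewrite inE.
case: ifP => //= _; last by rewrite mulr0 oppr0.
rewrite exprS mulN1r mulNr; congr (- (_ * (nat_of_bool _)%:R)).
apply: asbool_equiv_eq; split=> -[y yS]; exists y => x /= xS.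
  by apply: yS; apply/imfsetP; exists x.
by move: xS => /imfsetP[i /= iS ->]; exact: yS.
Qed.

End euler.

(** * Counting cells in an arc *)

Section arcs.
Local Open Scope nat_scope.

(** [x - s] modulo [M] for cells [s] and [x] below [M]: the number of steps forward from [s] to [x]
    around the cycle. *)
Definition offset (M s x : nat) : nat := if s <= x then x - s else x + M - s.

Definition in_arc (M L : nat) (I : finType) (S : {set I}) (c : I -> 'I_M) : bool :=
  [exists s : 'I_M, [forall i in S, offset M s (c i) < L]].

Lemma eq_in_arc (M L : nat) (I : finType) (S : {set I}) (c c' : I -> 'I_M) :
  c =1 c' -> in_arc L S c = in_arc L S c'.
Proof. by move=> cc'; apply: eq_existsb => s; apply: eq_forallb => i;
  rewrite cc'. Qed.

Lemma offset_lt (M : nat) (s x : 'I_M) : offset M s x < M.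
Proof. by rewrite /offset; case: ifP; have := ltn_ord s; have := ltn_ord x;
  lia. Qed.

Lemma card_ord_lt (M L : nat) : L <= M -> #|[set y : 'I_M | y < L]%SET| = L.
Proof.
move=> LM; rewrite cardsE -sum1_card -(big_ord_widen M (fun=> 1) LM).
by rewrite sum1_card card_ord.
Qed.

Lemma card_offset (M : nat) (s : 'I_M) (p : pred nat) :
  #|[pred x : 'I_M | p (offset M s x)]| = #|[set y : 'I_M | p y]%SET|.
Proof.
pose h x := Ordinal (offset_lt s x).
have hI : injective h.
  move=> x y /(congr1 val) /= e; apply: val_inj => /=; move: e.
  have := ltn_ord x; have := ltn_ord y; have := ltn_ord s.
  by rewrite /offset; case: ifP; case: ifP; lia.
rewrite -(card_preimset _ hI); apply: eq_card => x.
by rewrite !inE.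
Qed.

Lemma card_offset_lt (M L : nat) (s : 'I_M) : L <= M ->
  #|[pred x : 'I_M | offset M s x < L]| = L.
Proof. by move=> LM; rewrite (card_offset s (fun y => y < L)) card_ord_lt. Qed.

Lemma card_offset_gt0_lt (M L : nat) (s : 'I_M) : L <= M ->
  #|[pred x : 'I_M | 0 < offset M s x < L]| = L.-1.
Proof.
move=> LM; rewrite (card_offset s (fun y => 0 < y < L)).
case: L LM => [|L] LM; first by apply: eq_card0 => y; rewrite !inE ltn0 andbF.
have M0 : 0 < M by exact: leq_trans LM.
have := card_ord_lt LM; rewrite (cardsD1 (Ordinal M0)) inE /= add1n => -[LE].
by rewrite -[RHS]LE; apply: eq_card => y; rewrite !inE -val_eqE /= lt0n.
Qed.

Lemma prod_if_mem (I : finType) (S : {set I}) (u v : nat) :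
  \prod_(i : I) (if i \in S then u else v) = u ^ #|S| * v ^ (#|I| - #|S|).
Proof.
rewrite (bigID (mem S)) /=; congr muln.
  by rewrite -prod_nat_const; apply: eq_bigr => i ->.
have -> : #|I| - #|S| = #|~: S| by rewrite -(cardsC S) addKn.
rewrite -prod_nat_const.
by apply: eq_big => [i|i /negbTE -> //]; rewrite !inE.
Qed.

(* When [2 * L <= M] an arc of length [L] covers at most half a turn and has a well
   defined first point among the points it contains. *)
Lemma card_in_arc (M L : nat) (I : finType) (S : {set I}) :
  0 < #|S| -> 2 * L <= M ->
  #|[pred c : {ffun I -> 'I_M} | in_arc L S c]| =
  M * (L ^ #|S| - L.-1 ^ #|S|) * M ^ (#|I| - #|S|).
Proof.
move=> S0 LM; have LM' : L <= M by lia.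
(* [A s] collects the configurations whose first occupied cell is [s]; these sets partition the
   configurations that lie in an arc. *)
pose A (s : 'I_M) := [set c : {ffun I -> 'I_M} | [forall i in S, offset M s (c
  i) < L]
   && [exists i in S, c i == s]]%SET.
have offs s : offset M s s = 0 by rewrite /offset leqnn subnn.
(* If [s] and [s'] were distinct first cells, the forward steps from each to the other would both be
   below [L] and add up to [M], against [2 * L <= M]. *)
have A_partial (s s' : 'I_M) c : c \in A s -> c \in A s' -> s = s'.
  rewrite !inE => /andP[/forall_inP cs /exists_inP[i iS /eqP ci]].
  move=> /andP[/forall_inP cs' /exists_inP[j jS /eqP cj]].
  apply/val_inj => /=; move: (cs j jS) (cs' i iS); rewrite ci cj /offset.
  by have := ltn_ord s; have := ltn_ord s'; case: ifP; case: ifP; lia.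
have A_arc (c : {ffun I -> 'I_M}) : in_arc L S c = \sum_(s : 'I_M) (c \in A s)
  :> nat.
  case: (boolP (in_arc L S c)) => [/existsP[s /forall_inP cs]|noarc].
    have /card_gt0P[i0 i0S] := S0.
    (* The first occupied cell is that of an index with least offset. *)
    case: (@arg_minnP _ i0 (mem S) (fun i => offset M s (c i)) i0S) => i iS imin.
    have ciA : c \in A (c i).
      rewrite inE; apply/andP; split; last by apply/exists_inP; exists i.
      apply/forall_inP => j jS; have := imin j jS; have := cs j jS; have := cs i iS.
      rewrite /offset; have := ltn_ord s; have := ltn_ord (c i);
        have := ltn_ord (c j).
      by case: ifP; case: ifP; case: ifP; lia.
    rewrite (bigD1 (c i)) //= ciA big1 // => s' s's; apply/eqP; rewrite eqb0.
    by apply: contra s's => cA; rewrite (A_partial _ _ _ cA ciA).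
  rewrite big1 // => s _; apply/eqP; rewrite eqb0; apply: contra noarc.
  by rewrite inE => /andP[cs _]; apply/existsP; exists s.
have cardA s : #|A s| = (L ^ #|S| - L.-1 ^ #|S|) * M ^ (#|I| - #|S|).
  (* Choices constrained by [p] on [S] and free elsewhere. [A s] is the family for offsets below [L]
     minus the family for positive offsets below [L], which avoids [s]. *)
  pose F (p : pred nat) (i : I) : pred 'I_M :=
    [pred x : 'I_M | (i \in S) ==> p (offset M s x)].
  have cardF (p : pred nat) k : #|[pred x : 'I_M | p (offset M s x)]| = k ->
      #|(family (F p) : pred {ffun I -> 'I_M})| = k ^ #|S| * M ^ (#|I| - #|S|).
    move=> pk; rewrite card_family -prod_if_mem foldrE big_map big_enum /=.
    apply: eq_bigr => i _; rewrite /F; case: ifP => iS /=; first by rewrite -pk;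
      apply: eq_card.
    by rewrite -[RHS]card_ord; apply: eq_card.
  have e1 := cardF (fun y => y < L) L (card_offset_lt s LM').
  have e2 := cardF (fun y => 0 < y < L) L.-1 (card_offset_gt0_lt s LM').
  rewrite mulnBl -e1. rewrite -e2.
  set B := family _; set B' := family _.
  rewrite -[#|B|]cardsE -[#|B'|]cardsE.
  have sub : ([set x in B'] \subset [set x in B])%SET.
    apply/fintype.subsetP => c; rewrite !inE => /familyP cB; apply/familyP => i.
    by have := cB i; rewrite !inE; case: (i \in S) => //= /andP[].
  have memB c : (c \in [set x in B]%SET) = [forall i in S, offset M s (c i) < L].
    rewrite inE; apply/familyP/forall_inP => H i; have := H i; rewrite !inE.
      by move=> /implyP.
    by move=> H'; apply/implyP.
  rewrite -[in RHS](finset.setIidPr sub) -cardsD; apply: eq_card => c.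
  rewrite finset.in_setD memB [LHS]inE andbC.
  case: (boolP [forall i in S, offset M s (c i) < L]) => [/forall_inP cs|];
    last by rewrite !andbF.
  rewrite !andbT inE; apply/exists_inP/idP => [[i iS /eqP ci]|].
    by apply/negP => /familyP/(_ i); rewrite !inE iS ci offs.
  apply: contraNP => H; apply/familyP => i; rewrite !inE; apply/implyP => iS.
  rewrite cs // andbT lt0n; apply/negP => /eqP o0; apply: H; exists i => //.
  apply/eqP/ord_inj; move: o0; rewrite /offset; have := ltn_ord s;
    have := ltn_ord (c i).
  move: (nat_of_ord (c i)) (nat_of_ord s) => x y; case: ifP; lia.
rewrite -[RHS]mulnA.
transitivity (\sum_(c : {ffun I -> 'I_M}) \sum_(s : 'I_M) (c \in A s)).
  rewrite -sum1_card [LHS]big_mkcond /=; apply: eq_bigr => c _.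
  by rewrite -A_arc !inE; case: in_arc.
rewrite exchange_big /= -[X in X * _]card_ord -sum_nat_const.
apply: eq_bigr => s _; rewrite -(cardA s) -sum1_card [RHS]big_mkcond /=.
by apply: eq_bigr => c _; case: (c \in A s).
Qed.

Definition all_in_arc (M L d : nat) (I : finType) (S : {set I})
    (f : I -> {ffun 'I_d -> 'I_M}) : bool :=
  [forall j, in_arc L S (fun i => f i j)].

(** Exchanging points and coordinates by [flip] turns the coordinates into independent choices,
    hence the [d]-th power of the one-dimensional count. *)
Lemma card_all_in_arc (M L d : nat) (I : finType) (S : {set I}) :
  0 < #|S| -> 2 * L <= M ->
  #|[pred f : {ffun I -> {ffun 'I_d -> 'I_M}} | all_in_arc L S f]| =
  (M * (L ^ #|S| - L.-1 ^ #|S|) * M ^ (#|I| - #|S|)) ^ d.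
Proof.
move=> S0 LM; rewrite -(card_in_arc S0 LM) -[in RHS](card_ord d) -card_ffun_on.
pose flip (J K : finType) (T : Type) (f : {ffun J -> {ffun K -> T}}) :
  {ffun K -> {ffun J -> T}} := [ffun k => [ffun j => f j k]].
have flipK (J K : finType) (T : finType) : cancel (@flip J K T) (@flip K J T).
  by move=> f; apply/ffunP => i; apply/ffunP => j; rewrite !ffunE.
rewrite -(fintype.card_image (can_inj (flipK 'I_d I 'I_M))).
apply: eq_card => f; rewrite !inE; apply/idP/fintype.imageP.
  move=> /forallP fS; exists (flip _ _ _ f); last by rewrite flipK.
  apply/ffun_onP => j; rewrite inE -(eq_in_arc _ _ (_ : (fun i => f i j) =1 _)) //.
  by move=> i; rewrite !ffunE.
move=> [g /ffun_onP gS ->]; apply/forallP => j; have := gS j; rewrite inE.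
by move=> gj; rewrite (@eq_in_arc _ _ _ _ _ (g j)) // => i; rewrite /flip !ffunE.
Qed.

End arcs.

(** * Configurations with prescribed cell counts *)

Section multinomial.
Local Open Scope nat_scope.

Definition fibre_size (n : nat) (C : finType) (f : 'I_n -> C) (c : C) : nat :=
  \sum_(i < n) (f i == c).

Lemma sum_fibre_size (n : nat) (C : finType) (f : 'I_n -> C) :
  \sum_c fibre_size f c = n.
Proof.
rewrite exchange_big /= -[RHS]card_ord -sum1_card; apply: eq_bigr => i _.
by rewrite (bigD1 (f i)) //= eqxx big1 // => c /negbTE; rewrite eq_sym => ->.
Qed.

(** The multinomial coefficient, by induction on [n]: the first point takes a cell [c] with [m c]
    positive, and the others realise the counts with one unit removed at [c]. *)
Lemma card_fibre_size (n : nat) (C : finType) (m : C -> nat) :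
  \sum_c m c = n ->
  #|[pred f : {ffun 'I_n -> C} | [forall c, fibre_size f c == m c]]| *
    \prod_c (m c)`! = n`!.
Proof.
elim: n m => [|n IH] m.
  move=> /eqP; rewrite sum_nat_eq0 => /forallP m0.
  rewrite big1 ?muln1; last by move=> c _; have /= := m0 c => /eqP ->.
  rewrite (eq_card (B := predT)) ?card_ffun ?card_ord //.
  move=> f; rewrite !inE; apply/forallP => c; rewrite /fibre_size big_ord0 eq_sym.
  by have := m0 c.
move=> mn.
pose h (cf : C * {ffun 'I_n -> C}) : {ffun 'I_n.+1 -> C} :=
  [ffun i => if unlift ord0 i is Some j then cf.2 j else cf.1].
pose h' (f : {ffun 'I_n.+1 -> C}) : C * {ffun 'I_n -> C} :=
  (f ord0, [ffun j => f (lift ord0 j)]).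
have hK : cancel h h'.
  move=> [c f]; rewrite /h' ffunE unlift_none /=; congr pair.
  by apply/ffunP => j; rewrite !ffunE liftK.
have h'K : cancel h' h.
  move=> f; apply/ffunP => i; rewrite ffunE; case: unliftP => [j ->|->] //=.
  by rewrite ffunE.
have hm c f c' : fibre_size (h (c, f)) c' = (c == c') + fibre_size f c'.
  rewrite /fibre_size big_ord_recl ffunE unlift_none /=; congr addn.
  by apply: eq_bigr => j _; rewrite ffunE liftK.
rewrite -sum1_card (reindex h) /=; last by exists h' => x _; [exact: hK|exact: h'K].
rewrite (eq_bigl (fun cf : C * {ffun 'I_n -> C} =>
  [forall c', (cf.1 == c') + fibre_size cf.2 c' == m c'])); last first.
  by move=> [c f]; rewrite !inE; apply: eq_forallb => c'; rewrite hm.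
rewrite -(pair_big_dep xpredT (fun c (f : {ffun 'I_n -> C}) => [forall c', (c
  == c') + fibre_size f c' == m c']) (fun _ _ => 1)) /=.
have -> : n.+1`! = \sum_c m c * n`! by rewrite factS -[in LHS]mn big_distrl.
rewrite big_distrl /=; apply: eq_bigr => c _.
rewrite sum1_card; case: (posnP (m c)) => mc.
  rewrite eq_card0 ?mul0n ?mc // => f; rewrite !inE;
    apply/negbTE/negP => /forallP/(_ c).
  by rewrite eqxx mc.
pose m' c' := m c' - (c == c').
have m'm c' : m c' = (c == c') + m' c'.
  by rewrite /m'; case: eqP => [<-|]; rewrite ?subn0 // subnKC.
have m'n : \sum_c' m' c' = n.
  apply/eqP; rewrite -eqSS -mn; apply/eqP; rewrite -add1n.
  rewrite [RHS](eq_bigr _ (fun c' _ => m'm c')) big_split /=; congr addn.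
  by rewrite (bigD1 c) //= eqxx big1 // => c' /negbTE; rewrite eq_sym => ->.
rewrite -(IH _ m'n) (eq_card (B := [pred f : {ffun 'I_n -> C} | [forall c,
  fibre_size f c == m' c]])); last first.
  by move=> f; rewrite !inE; apply: eq_forallb => c'; rewrite m'm eqn_add2l.
rewrite mulnCA; congr muln; rewrite (bigD1 c) //= [in RHS](bigD1 c) //= mulnA.
congr muln.
  by rewrite -[in LHS](prednK mc) factS prednK // /m' eqxx subn1.
by apply: eq_bigr => c' /negbTE; rewrite /m' eq_sym => ->; rewrite subn0.
Qed.

(** Equal counts make the two tuples of values permutations of each other. *)
Lemma fibre_size_perm (n : nat) (C : finType) (f g : 'I_n -> C) :
  fibre_size f =1 fibre_size g -> exists s : 'S_n, g =1 f \o s.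
Proof.
move=> fg.
have countE (h : 'I_n -> C) c : count_mem c (mktuple h) = fibre_size h c.
  rewrite count_map -sum1_count big_mkcond big_enum /=; apply: eq_bigr => i _.
  by case: eqP.
have : perm_eq (mktuple g) (mktuple f).
  by apply/allP => c _; rewrite /= !countE fg.
move=> /tuple_permP[s gs]; exists s => i.
have -> : g i = tnth (mktuple g) i by rewrite tnth_mktuple.
by rewrite (tnth_nth (g i)) gs -tnth_nth !tnth_mktuple.
Qed.

End multinomial.

(** * The discrete Euler characteristic *)

Section arc_euler.
Context {R : realType}.

(** The sum of [cech_euler_image], with the meeting of balls replaced by the arc event on cells. *)
Definition arc_euler (M L d n : nat) (f : 'I_n -> {ffun 'I_d -> 'I_M}) : R :=
  \sum_(S : {set 'I_n} | S != finset.set0)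
    (-1) ^+ #|S|.+1 * (all_in_arc L S f)%:R.

(** A relabelling permutes the index sets [S] and preserves their sizes. *)
Lemma arc_euler_perm (M L d n : nat) (f g : 'I_n -> {ffun 'I_d -> 'I_M}) (s :
  'S_n) :
  g =1 f \o s -> arc_euler L g = arc_euler L f.
Proof.
move=> gfs; rewrite /arc_euler.
rewrite [RHS](reindex_inj (h := fun S : {set 'I_n} => (s @: S)%SET)) /=;
  last exact/imset_inj/perm_inj.
apply: eq_big => [S|S _]; first by rewrite imset_eq0.
rewrite card_imset; last exact: perm_inj.
congr (_ * (nat_of_bool _)%:R); apply: eq_forallb => j; apply: eq_existsb => t.
apply/forall_inP/forall_inP => [H _ /finset.imsetP[i iS ->]|H i iS].
  by have := H i iS; rewrite gfs.
by rewrite gfs /=; apply: H; apply/finset.imsetP; exists i.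
Qed.

(** The bound depends neither on [M] nor on [L], so it dominates the sequence obtained by refining
    the cells. *)
Lemma norm_arc_euler (M L d n : nat) (f : 'I_n -> {ffun 'I_d -> 'I_M}) :
  `|arc_euler L f| <= (2 ^ n)%:R.
Proof.
apply: (le_trans (ler_norm_sum _ _ _)).
rewrite big_mkcond; apply: (@le_trans _ _ (\sum_(S : {set 'I_n}) 1)).
  apply: ler_sum => S _; case: ifP => // _.
  by rewrite normrM normrX normrN1 expr1n mul1r; case: all_in_arc;
    rewrite ?normr1 ?normr0.
by rewrite sumr_const /= -cardsT -powersetT card_powerset cardsT card_ord.
Qed.

Lemma sum_over_subsets (n : nat) (F : nat -> R) :
  \sum_(S : {set 'I_n}) F #|S| = \sum_(0 <= k < n.+1) 'C(n, k)%:R * F k.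
Proof.
rewrite (partition_big (fun S : {set 'I_n} => inord #|S| : 'I_n.+1) xpredT) //=.
rewrite big_mkord; apply: eq_bigr => k _.
have -> : 'C(n, k) = #|[set A : {set 'I_n} | #|A| == k]%SET| by rewrite
  card_draws card_ord.
rewrite mulr_natl -sumr_const /=.
apply: eq_big => [S|S /eqP <-].
  rewrite inE -val_eqE /= inordK // ltnS -[X in (_ <= X)%N](card_ord n).
  exact: max_card.
by rewrite inordK // ltnS -[X in (_ <= X)%N](card_ord n); exact: max_card.
Qed.

Lemma mean_arc_euler (M L d n : nat) : (0 < d)%N -> (0 < M)%N -> (2 * L <= M)%N ->
  (\sum_(f : {ffun 'I_n -> {ffun 'I_d -> 'I_M}}) arc_euler L f) / ((M ^ d) ^ n)%:R =
  \sum_(0 <= k < n.+1) 'C(n, k)%:R * ((-1) ^+ k.+1 *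
     (M%:R * (L ^ k - L.-1 ^ k)%:R / M%:R ^+ k) ^+ d).
Proof.
move=> d0 M0 LM.
rewrite -(@sum_over_subsets n (fun k => (-1) ^+ k.+1 *
     (M%:R * (L ^ k - L.-1 ^ k)%:R / M%:R ^+ k) ^+ d)).
rewrite exchange_big /= mulr_suml big_mkcond; apply: eq_bigr => S _.
have [->|S0] /= := eqVneq S finset.set0.
  (* The empty set contributes nothing: the right-hand term for [k = 0] contains [0 ^ d], and [d] is
     positive. *)
  by rewrite cards0 !expn0 subnn mulr0 mul0r expr0n (gtn_eqF d0) mulr0.
rewrite -mulr_sumr -mulrA; congr (_ * _).
have -> : \sum_(f : {ffun 'I_n -> {ffun 'I_d -> 'I_M}}) (all_in_arc L S f)%:R =
    #|[pred f : {ffun 'I_n -> {ffun 'I_d -> 'I_M}} | all_in_arc L S f]|%:R :> R.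
  rewrite -sum1_card natr_sum [RHS]big_mkcond /=; apply: eq_bigr => f _.
  by rewrite inE; case: all_in_arc.
rewrite card_all_in_arc ?card_gt0 // card_ord.
have Sn : (#|S| <= n)%N by rewrite -[X in (_ <= X)%N](card_ord n) max_card.
rewrite expnAC !natrX -expr_div_n; congr (_ ^+ d).
have M0' : M%:R != 0 :> R by rewrite pnatr_eq0 -lt0n.
move: #|S| Sn => k kn; rewrite 2!natrM natrX (_ : M%:R ^+ n = M%:R ^+ (n - k) *
  M%:R ^+ k :> R); last by rewrite -exprD subnK.
by field; rewrite !expf_neq0.
Qed.

(** [L ^ k - (L - 1) ^ k] is a sum of [k] products of [k - 1] factors [L] or [L - 1]; divided by
    [M ^ (k - 1)], each product tends to [r ^ (k - 1)]. *)
Lemma cvg_mean_arc_euler (r : R) (d n : nat) (L : nat^nat) :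
  (0 < d)%N -> 0 < r ->
  (forall m, r * m.+1%:R - 2 <= (L m)%:R <= r * m.+1%:R) ->
  \sum_(0 <= k < n.+1) 'C(n, k)%:R * ((-1) ^+ k.+1 *
     (m.+1%:R * (L m ^ k - (L m).-1 ^ k)%:R / m.+1%:R ^+ k) ^+ d) @[m --> \oo] -->
  \sum_(0 <= k < n.+1)
    (-1) ^+ k.+1 * 'C(n, k)%:R * k%:R ^+ d * r ^ (d%:Z * (k%:Z - 1)).
Proof.
move=> d0 r0 Lm.
(* The slack 3 instead of 2 lets the same claim apply to [L m] and to [(L m).-1]. *)
have L_r (L' : nat^nat) : (forall m, r * m.+1%:R - 3 <= (L' m)%:R <= r * m.+1%:R) ->
    (L' m)%:R / m.+1%:R @[m --> \oo] --> r.
  move=> L'm; apply: (@squeeze_cvgr _ _ _ _ (fun m => r - 3 * harmonic m)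
    (fun=> r)).
  - apply: nearW => m; have := L'm m; rewrite ler_pdivlMr // ler_pdivrMr //.
    move=> /andP[Lr ->]; rewrite andbT mulrBl /harmonic -mulrA mulVf ?mulr1 //.
  - rewrite -[X in _ --> X]subr0 -[X in _ - X](mulr0 3).
    by apply: cvgB; [exact: cvg_cst | apply: cvgMl_tmp; exact: cvg_harmonic].
  - exact: cvg_cst.
have L_gt0 : \forall m \near \oo, (0 < L m)%N.
  near=> m; have /andP[Lm' _] := Lm m; rewrite -(ltr0n R) (lt_le_trans _ Lm') //.
  rewrite subr_gt0 mulrC -ltr_pdivrMr //.
  have : 2 / r <= m%:R by near: m; exact: nbhs_infty_ger.
  by move=> /le_lt_trans; apply; rewrite ltr_nat.
have cvgL : (L m)%:R / m.+1%:R @[m --> \oo] --> r.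
  by apply: L_r => m; have /andP[h ->] := Lm m; rewrite andbT; lra.
have cvgL1 : (L m).-1%:R / m.+1%:R @[m --> \oo] --> r.
  apply: L_r => m; have /andP[h1 h2] := Lm m.
  have : ((L m).-1%:R : R) <= (L m)%:R by rewrite ler_nat leq_pred.
  have : ((L m)%:R : R) <= (L m).-1%:R + 1 by rewrite natr1 ler_nat leqSpred.
  by move=> h3 h4; apply/andP; split; lra.
have cvg_sumR (I : Type) (s : seq I) (F : I -> nat -> R) (l : I -> R) :
    (forall i, F i m @[m --> \oo] --> l i) ->
    \sum_(i <- s) F i m @[m --> \oo] --> \sum_(i <- s) l i.
  by move=> Fl; apply: cvg_big => //; exact: add_continuous.
have cvg_exp (u : nat -> R) (l : R) k : u m @[m --> \oo] --> l ->
    u m ^+ k @[m --> \oo] --> l ^+ k.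
  by move=> ul; apply: (cvg_comp u (fun x : R => x ^+ k) ul);
    exact: exprn_continuous.
apply: (cvg_sumR) => k.
rewrite -!mulrA [(-1) ^+ _ * _]mulrCA; apply: cvgMl_tmp; apply: cvgMl_tmp.
(* At [k = 0] the exponent of [r] on the left is negative, but [k%:R ^+ d] vanishes because [d] is
   positive. *)
have -> : k%:R ^+ d * r ^ (d%:Z * (k%:Z - 1)) = (k%:R * r ^+ k.-1) ^+ d.
  rewrite exprMn; case: k => [|k]; first by rewrite expr0n (gtn_eqF d0) !mul0r.
  have -> : k.+1%:Z - 1 = k%:Z by lia.
  by rewrite -PoszM -exprM mulnC.
apply: (cvg_exp).
have : \sum_(i <- index_enum 'I_k)
   ((L m)%:R / m.+1%:R) ^+ (k.-1 - i) * ((L m).-1%:R / m.+1%:R) ^+ i @[m -->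
     \oo] --> k%:R * r ^+ k.-1.
  have -> : k%:R * r ^+ k.-1 = \sum_(i < k) r ^+ (k.-1 - i) * r ^+ i.
    under eq_bigr => i _.
      rewrite -exprD subnK; last by have := ltn_ord i; case: (k) i => // k' i;
        rewrite ltnS.
      over.
    by rewrite sumr_const card_ord mulr_natl.
  by apply: (cvg_sumR) => i; apply: cvgM; exact: cvg_exp.
apply: cvg_trans; apply: near_eq_cvg; near=> m.
(* Positivity gives [L m - (L m).-1 = 1], the factor in front of the sum. *)
have L0 : (0 < L m)%N by near: m.
rewrite subn_exp -[in X in (X - _)%N](prednK L0) subSnn mul1n natr_sum.
case: k => [|k]; first by rewrite !big_ord0 mulr0 mul0r.
have M0 : m.+1%:R != 0 :> R by rewrite pnatr_eq0.
set T := \sum_(i < k.+1) (_ ^ _ * _ ^ _)%:R.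
have -> : m.+1%:R * T / m.+1%:R ^+ k.+1 = T / m.+1%:R ^+ k.
  by rewrite exprS invfM mulrA [_ * T]mulrC mulfK.
rewrite /T mulr_suml; apply: eq_bigr => i _.
have -> : m.+1%:R ^+ k = m.+1%:R ^+ (k - i) * m.+1%:R ^+ i :> R.
  by rewrite -exprD subnK // -ltnS.
by rewrite natrM !natrX !expr_div_n /= mulf_div.
Unshelve. all: by end_near. Qed.

End arc_euler.

(** * Cells and arcs on the circle *)

(** [u] counts full turns; the bounds leave only [u = 0] and [u = 1], which match the two branches
    of [offset]. *)
Lemma offset_lt_modz (M L c s : nat) (u : int) :
  (c < M)%N -> (s < M)%N -> (2 * L <= M)%N ->
  0 <= c%:Z - s%:Z + u * M%:Z < L%:Z -> (offset M s c < L)%N.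
Proof.
move=> cM sM LM /andP[lo up]; rewrite /offset.
have u_ge0 : 0 <= u.
  rewrite leNgt; apply/negP => u0.
  have : u * M%:Z <= -1 * M%:Z by rewrite ler_wpM2r //; lia.
  lia.
have u_le1 : u <= 1.
  rewrite leNgt; apply/negP => u1.
  have : 2%:Z * M%:Z <= u * M%:Z by rewrite ler_wpM2r //; lia.
  lia.
have [u0|u1] : u = 0 \/ u = 1 by lia.
  by rewrite u0 in lo up; case: (leqP s c) => sc; lia.
by rewrite u1 in lo up; case: (leqP s c) => sc; lia.
Qed.

Section cells.
Context {R : realType}.
Variables (a eps : R).
Hypotheses (a_gt0 : 0 < a) (eps_gt0 : 0 < eps) (eps_lt : eps < a / 4%:R).

(** On [[0, a)] the truncation is at most [m], so [inord] does not fall back on its default. *)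
Definition cell1 (m : nat) (x : R) : 'I_m.+1 := inord (Num.trunc (x * m.+1%:R / a)).

Lemma cell1P (m : nat) (x : R) (c : 'I_m.+1) : 0 <= x < a ->
  (cell1 m x == c) = (c%:R * (a / m.+1%:R) <= x < c.+1%:R * (a / m.+1%:R)).
Proof.
move=> /andP[x0 xa]; have y0 : 0 <= x * m.+1%:R / a by rewrite divr_ge0
  ?mulr_ge0 // ltW.
have -> : (cell1 m x == c) = (Num.trunc (x * m.+1%:R / a) == c).
  rewrite -val_eqE /= inordK // truncn_lt_nat //.
  by rewrite ltr_pdivrMr // mulrC ltr_pM2l.
by rewrite truncn_eq // ler_pdivlMr // ltr_pdivrMr // !mulrA ler_pdivrMr //
  ltr_pdivlMr.
Qed.

Lemma cell1_itv (m : nat) (x : R) : 0 <= x < a ->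
  (cell1 m x)%:R * (a / m.+1%:R) <= x < (cell1 m x).+1%:R * (a / m.+1%:R).
Proof. by move=> xa; rewrite -cell1P. Qed.

(* The predecessor makes the arc strictly shorter than [2 * eps], so that its
   points are at distance less than [eps] from its centre. *)
Definition arc_cells (m : nat) : nat := (Num.trunc (2 * eps / a * m.+1%:R)).-1.

Lemma arc_cells_itv (m : nat) :
  2 * eps / a * m.+1%:R - 2 <= (arc_cells m)%:R <= 2 * eps / a * m.+1%:R.
Proof.
have y0 : 0 <= 2 * eps / a * m.+1%:R by rewrite mulr_ge0 // divr_ge0 ?mulr_ge0
  // ltW.
have /andP[h1 h2] := truncn_itv y0; rewrite /arc_cells.
set t := Num.trunc _ in h1 h2 *.
have h3 : (t.-1%:R : R) <= t%:R by rewrite ler_nat leq_pred.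
have h4 : (t%:R : R) <= t.-1%:R + 1 by rewrite natr1 ler_nat leqSpred.
by rewrite -natr1 in h2; apply/andP; split; lra.
Qed.

Lemma arc_cells_lt (m : nat) : (arc_cells m)%:R * (a / m.+1%:R) < 2 * eps.
Proof.
have y0 : 0 < 2 * eps / a * m.+1%:R by rewrite mulr_gt0 // divr_gt0 ?mulr_gt0.
rewrite mulrA ltr_pdivrMr // -ltr_pdivlMr // mulrAC /arc_cells.
have /andP[h1 h2] := truncn_itv (ltW y0).
case: (Num.trunc _) h1 => [//|t] h1 /=; apply: lt_le_trans h1.
by rewrite ltr_nat.
Qed.

(** An arc shorter than [2 * eps] covers less than half the circle because [eps < a / 4]; the count
    in [card_in_arc] relies on it. *)
Lemma arc_cells_half (m : nat) : (2 * arc_cells m <= m.+1)%N.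
Proof.
rewrite -(ler_nat R) natrM.
have h := arc_cells_lt m; rewrite mulrA ltr_pdivrMr // in h.
have e4 : 4 * eps < a by rewrite mulrC -ltr_pdivlMr.
rewrite -(ler_pM2r a_gt0).
have m0 : 0 < m.+1%:R :> R by [].
have : 4 * eps * m.+1%:R <= a * m.+1%:R by rewrite ler_pM2r // ltW.
lra.
Qed.

(** The circle version of balls with a common point: [k] makes the distance one modulo [a]. *)
Definition arcs_meet (I : finType) (S : {set I}) (x : I -> R) : Prop :=
  exists t, forall i, i \in S -> exists k : int, `|x i - t + k%:~R * a| < eps.

Lemma in_arc_arcs_meet (m : nat) (I : finType) (S : {set I}) (x : I -> R) :
  (forall i, 0 <= x i < a) ->
  in_arc (arc_cells m) S (cell1 m \o x) -> arcs_meet S x.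
Proof.
move=> xa /existsP[s /forall_inP Ss].
set h := a / m.+1%:R; set L := arc_cells m.
have h0 : 0 < h by rewrite divr_gt0.
have Lh : L%:R * h < 2 * eps := arc_cells_lt m.
have Mh : m.+1%:R * h = a by rewrite /h mulrCA mulfV ?mulr1.
(* The common point is the midpoint of the arc of [L] cells starting at [s], whose half-length
   [L * h / 2] is below [eps]. *)
exists ((s%:R + L%:R / 2) * h) => i iS; have := Ss i iS; rewrite /offset /= -/L.
have := cell1_itv m (xa i); rewrite -/h; set c := cell1 m (x i) => /andP[c1 c2].
rewrite -natr1 in c2.
case: (leqP s c) => sc cL; [exists 0|exists 1].
  have : (c%:R : R) - s%:R + 1 <= L%:R.
    by rewrite -natrB // natr1 ler_nat.
  have : (0:R) <= c%:R - s%:R by rewrite subr_ge0 ler_nat.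
  rewrite -(ler_pM2r h0) => H1; rewrite -(ler_pM2r h0) => H2.
  by rewrite ltr_norml; apply/andP; split; lra.
have sM : (s <= c + m.+1)%N by apply/ltnW/ltn_addl/ltn_ord.
have : (c%:R : R) + m.+1%:R - s%:R + 1 <= L%:R.
  by rewrite -natrD -natrB // natr1 ler_nat.
have : (0:R) <= c%:R + m.+1%:R - s%:R.
  by rewrite subr_ge0 -natrD ler_nat.
rewrite -(ler_pM2r h0) => H1; rewrite -(ler_pM2r h0) => H2.
by rewrite ltr_norml; apply/andP; split; lra.
Qed.

(** An arc starting in the cell of [t - eps] works once the cells are fine: the strict inequalities
    at the finitely many points leave room before [t + eps]. *)
Lemma arcs_meet_in_arc (I : finType) (S : {set I}) (x : I -> R) :
  (forall i, 0 <= x i < a) -> arcs_meet S x ->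
  \forall m \near \oo, in_arc (arc_cells m) S (cell1 m \o x).
Proof.
move=> xa [t St].
have /choice[k Sk] : forall i, exists k : int, i \in S -> `|x i - t + k%:~R *
  a| < eps.
  by move=> i; case: (boolP (i \in S)) => [/St[k kP]|_]; [exists k | exists 0].
(* A gap of three cells below [t + eps]: two pay for the deficit in [arc_cells_itv], one for
   rounding the start of the arc. *)
have : \forall m \near \oo, forall i, i \in S ->
    3 * a <= (eps - (x i - t + (k i)%:~R * a)) * m.+1%:R.
  apply: filter_forall => i; case: (boolP (i \in S)) => [iS|_]; last exact: nearW.
  have d0 : 0 < eps - (x i - t + (k i)%:~R * a).
    by rewrite subr_gt0; exact: le_lt_trans (ler_norm _) (Sk i iS).
  near=> m => _; rewrite [X in _ <= X]mulrC -ler_pdivrMr //.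
  apply: (@le_trans _ _ m%:R); last by rewrite ler_nat.
  by near: m; exact: nbhs_infty_ger.
apply: filterS => m Hm.
set M := m.+1; set L := arc_cells m.
have M0 : 0 < M%:R :> R by [].
(* The position of [t - eps] in units of cells. Its floor [s0], reduced modulo [M], is the starting
   cell [s], and [q] counts the turns. *)
set T := (t - eps) * M%:R / a.
set s0 := Num.floor T.
have sM : (s0 %% M)%Z >= 0 by rewrite modz_ge0.
have sM' : (s0 %% M)%Z < M by rewrite ltz_mod.
have sMn : (`|(s0 %% M)%Z| < M)%N by lia.
pose s : 'I_M := Ordinal sMn.
have s0E : s0 = (s0 %/ M)%Z * M + (s : nat)%:Z.
  by rewrite /= gez0_abs // -divz_eq.
set q := (s0 %/ M)%Z in s0E.
apply/existsP; exists s; apply/forall_inP => i iS.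
have := cell1_itv m (xa i); rewrite /= -/M; set c := cell1 m (x i) => /andP[c1 c2].
have := Sk i iS; rewrite ltr_norml => /andP[k1 k2].
have /andP[T1 T2] := floor_itv T; rewrite -/s0 in T1 T2.
have Hi := Hm i iS.
have xi : (c%:R : R) <= x i * M%:R / a < c%:R + 1.
  by rewrite ler_pdivlMr // ltr_pdivrMr // natr1 -ler_pdivrMr // -ltr_pdivlMr
    // -!mulrA c1 c2.
have {xi}[xi1 xi2] : (c%:R : R) <= x i * M%:R / a /\ x i * M%:R / a < c%:R + 1
  by case/andP: xi.
have kM : T < x i * M%:R / a + (k i)%:~R * M%:R.
  rewrite /T ltr_pdivrMr // [X in _ < X]mulrDl divfK ?gt_eqF //.
  by rewrite -(ltr_pM2r M0) in k1; lra.
have kL : x i * M%:R / a + (k i)%:~R * M%:R - T + 1 <= L%:R.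
  have /andP[L1 _] := arc_cells_itv m; rewrite -/L -/M in L1.
  apply: le_trans L1; rewrite /T.
  have -> : x i * M%:R / a + (k i)%:~R * M%:R - (t - eps) * M%:R / a + 1 =
    (2 * eps * M%:R - (eps - (x i - t + (k i)%:~R * a)) * M%:R) / a + 1.
    by field; rewrite gt_eqF.
  rewrite -mulrA [X in _ <= X - _]mulrAC mulrBl.
  have : 3 <= (eps - (x i - t + (k i)%:~R * a)) * M%:R / a by rewrite ler_pdivlMr.
  rewrite mulrA; lra.
have lo : s0 <= (c : nat)%:Z + k i * M.
  rewrite -ltzD1 -(ltr_int R) !rmorphD rmorphM /=.
  have -> : (c : nat)%:~R = c%:R :> R by [].
  have -> : M%:~R = M%:R :> R by [].
  rewrite mulr1z; lra.
have up : (c : nat)%:Z + k i * M - s0 < L.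
  rewrite -(ltr_int R) rmorphB !rmorphD rmorphM /=.
  have -> : (c : nat)%:~R = c%:R :> R by [].
  have -> : M%:~R = M%:R :> R by [].
  have -> : L%:~R = L%:R :> R by [].
  rewrite rmorphD /= mulr1z in T2; lra.
have LM : (2 * L <= M)%N := arc_cells_half m.
have cM := ltn_ord c; have sM2 := ltn_ord s.
apply: (@offset_lt_modz _ _ _ _ (k i - q)) => //.
have -> : (c : nat)%:Z - (s : nat)%:Z + (k i - q) * M = (c : nat)%:Z + k i * M - s0.
  by rewrite s0E; ring.
by rewrite subr_ge0 lo up.
Unshelve. all: by end_near. Qed.

End cells.

(** * Cells of the torus and their volume *)

Section torus_cells.
Context {R : realType}.
Variables (d : nat) (a eps : R).
Hypotheses (a_gt0 : 0 < a) (eps_gt0 : 0 < eps) (eps_lt : eps < a / 4%:R).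

(** The sup norm lets the shift be chosen coordinate by coordinate, and the infimum is below [eps]
    exactly when some member is. *)
Lemma torus_dist_lt (x y : Rd R d) :
  torus_dist a x y < eps <->
  forall j, exists k : int, `|tnth x j - tnth y j + k%:~R * a| < eps.
Proof.
have normE (m : 'I_d -> int) :
    (`| \row_(i < d) (tnth x i - tnth y i + (m i)%:~R * a) : 'rV[R]_d | < eps) =
    [forall j, `|tnth x j - tnth y j + (m j)%:~R * a| < eps].
  rewrite {1}/Num.norm /= mx_normrE; apply/bigmax_ltP/forallP.
    by move=> [_ H] j; have := H (ord0, j) isT; rewrite mxE.
  by move=> H; split => // -[i j] _; rewrite mxE.
split=> [/inf_lt|H].
  case; first by exists `| \row_(i < d) (tnth x i - tnth y i + 0%:~R * a) :
    'rV[R]_d |; exists (fun=> 0).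
  by move=> _ [m ->]; rewrite normE => /forallP H j; exists (m j).
have /choice[m mP] := H.
apply: le_lt_trans (_ : `| \row_(i < d) (tnth x i - tnth y i + (m i)%:~R * a) :
  'rV[R]_d | < eps).
  apply: ge_inf; last by exists m.
  by exists 0 => _ [k ->].
by rewrite normE; apply/forallP.
Qed.

Lemma torus_balls_meet (I : finType) (S : {set I}) (v : I -> Rd R d) :
  (\bigcap_(i in [set` S]) torus_ball a (v i) eps !=set0) <->
  forall j, arcs_meet a eps S (fun i => tnth (v i) j).
Proof.
split=> [[y yS] j|H].
  by exists (tnth y j) => i iS; have [_ /torus_dist_lt/(_ j)] := yS i iS.
have /choice[t tP] := H.
(* [k j] is the number of periods to subtract so that [t j] falls in [[0, a)]. *)
pose k j := Num.floor (t j / a).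
exists [tuple t j - (k j)%:~R * a | j < d] => i /= iS; split.
  move=> j; rewrite tnth_mktuple.
  have := floor_itv (t j / a); rewrite -/(k j) => /andP[].
  rewrite ler_pdivlMr // ltr_pdivrMr // rmorphD /= mulrDl mul1r => h1 h2.
  by apply/andP; split; lra.
apply/torus_dist_lt => j; have [m mP] := tP j i iS.
exists (m - k j); rewrite tnth_mktuple rmorphB /= mulrBl.
by move: mP; rewrite opprB; congr (`|_| < _); ring.
Qed.

Definition cell (m : nat) (x : Rd R d) : {ffun 'I_d -> 'I_m.+1} :=
  [ffun j => cell1 a m (tnth x j)].

(** If the balls have no common point, the arc event fails at every [m]; if they have one, it holds
    eventually. Finitely many sets [S] and coordinates allow a common threshold. *)
Lemma near_arc_euler (n : nat) (v : 'I_n -> Rd R d) :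
  (forall i, torus a (v i)) ->
  \forall m \near \oo, arc_euler (arc_cells a eps m) (cell m \o v) =
    (cech_euler a eps [fset v i | i in 'I_n]%fset)%:~R :> R.
Proof.
move=> va.
have : \forall m \near \oo, forall S : {set 'I_n},
    all_in_arc (arc_cells a eps m) S (cell m \o v) =
    `[< \bigcap_(i in [set` S]) torus_ball a (v i) eps !=set0 >].
  apply: filter_forall => S.
  have arcE m j : in_arc (arc_cells a eps m) S (fun i => (cell m \o v) i j) =
      in_arc (arc_cells a eps m) S (cell1 a m \o (fun i => tnth (v i) j)).
    by apply: eq_in_arc => i; rewrite /= ffunE.
  have va' j i : 0 <= tnth (v i) j < a by exact: va.
  have [meet|nomeet] := asboolP (_ !=set0); last first.
    apply: nearW => m; apply/negbTE/negP => /forallP H; apply: nomeet.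
    apply/torus_balls_meet => j; have := H j; rewrite arcE.
    exact: in_arc_arcs_meet.
  have : \forall m \near \oo, forall j,
      in_arc (arc_cells a eps m) S (cell1 a m \o (fun i => tnth (v i) j)).
    apply: filter_forall => j; apply: arcs_meet_in_arc => //.
    by move/torus_balls_meet : meet; exact.
  by apply: filterS => m H; apply/forallP => j; rewrite arcE.
apply: filterS => m H.
rewrite cech_euler_image rmorph_sum /=; apply: eq_bigr => S _.
by rewrite H rmorphM rmorphXn rmorphN1 rmorph_nat.
Qed.

Definition box (A : 'I_d -> set R) : set (Rd R d) :=
  [set x | forall j, A j (tnth x j)].

Lemma measurable_box (A : 'I_d -> set R) :
  (forall j, measurable (A j)) -> measurable (box A).
Proof.
move=> mA; have -> : box A = \bigcap_(j in [set: 'I_d]) ((fun x : Rd R d =>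
  tnth x j) @^-1` A j).
  by apply/seteqP; split => [x xA j _|x xA j]; [exact: xA | exact: (xA j I)].
apply: fin_bigcap_measurable => // j _; rewrite -[X in measurable X]setTI.
exact: (@measurable_tnth _ (measurableTypeR R) d j measurableT _ (mA j)).
Qed.

Definition cell_box (m : nat) (c : {ffun 'I_d -> 'I_m.+1}) : set (Rd R d) :=
  box (fun j => `[(c j)%:R * (a / m.+1%:R), (c j).+1%:R * (a / m.+1%:R)[%classic).

Lemma torusE : torus a = box (fun=> `[0, a[%classic).
Proof. by apply/seteqP; split => x H j; have := H j; rewrite /= in_itv. Qed.

Lemma measurable_torus : measurable (torus a : set (Rd R d)).
Proof. by rewrite torusE; apply: measurable_box => j; exact: measurable_itv. Qed.

Lemma measurable_cell_box m c : measurable (@cell_box m c).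
Proof. by apply: measurable_box => j; exact: measurable_itv. Qed.

Lemma cell_box_torus m c : @cell_box m c `<=` torus a.
Proof.
move=> x xc j; have := xc j; rewrite /= in_itv /= => /andP[h1 h2].
have h0 : 0 <= a / m.+1%:R by rewrite divr_ge0 // ltW.
apply/andP; split; first by apply: le_trans h1; rewrite mulr_ge0.
apply: (lt_le_trans h2); rewrite mulrA ler_pdivrMr // mulrC ler_pM2l // ler_nat.
exact: ltn_ord.
Qed.

Lemma cell_boxP m c x : torus a x -> @cell_box m c x <-> cell m x = c.
Proof.
move=> xa; split=> [xc|<- j].
  apply/ffunP => j; rewrite ffunE; apply/eqP; rewrite cell1P //.
  by have := xc j; rewrite /= in_itv.
by rewrite /= in_itv /= ffunE; exact: cell1_itv.
Qed.

End torus_cells.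

Section volume_box.
Context {R : realType}.

Lemma volume0 (d : nat) : @volume R d set0 = 0%E.
Proof.
elim: d => [|d IH] /=; first by rewrite measure0.
rewrite /pushforward preimage_set0 /product_measure1.
by rewrite integral0_eq // => x _; rewrite /= xsection0.
Qed.

(** The section of a box over [x] is the box of the remaining factors if [x] lies in [A ord0] and
    empty otherwise, so the integral is that of a constant on [A ord0]. *)
Lemma volume_box (d : nat) (A : 'I_d -> set R) (l : 'I_d -> R) :
  (forall j, measurable (A j)) ->
  (forall j, lebesgue_measure (A j) = (l j)%:E) ->
  volume (box A) = (\prod_j l j)%:E.
Proof.
elim: d A l => [|d IH] A l mA Al.
  rewrite big_ord0 /= diracE mem_set //; last by case.
rewrite big_ord_recl /= /pushforward /product_measure1.
have IH' := IH (fun j => A (lift ord0 j)) (fun j => l (lift ord0 j)) (fun j =>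
  mA _) (fun j => Al _).
under eq_integral => x _.
  have -> : (@volume R d \o xsection
      ((fun p : measurableTypeR R * Rd R d => [tuple of p.1 :: p.2]) @^-1` box
        A)) x =
      ((cst (\prod_(j < d) l (lift ord0 j))%:E) \_ (A ord0)) x.
    rewrite patchE /=; case: ifPn => xA.
      rewrite -IH'; congr volume; apply/seteqP; split => y; rewrite /xsection /=.
        by move=> /set_mem H j; have := H (lift ord0 j); rewrite /= tnthS.
      move=> H; apply/mem_set => j; case: (unliftP ord0 j) => [k ->|->] /=;
        first by rewrite tnthS; exact: H.
      by rewrite tnth0; exact: set_mem.
    have -> : xsection ((fun p : measurableTypeR R * Rd R d => [tuple of p.1 ::
      p.2]) @^-1` box A) x = set0.
      rewrite -subset0 => y; rewrite /xsection /= => /set_mem/(_ ord0) /=;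
        rewrite tnth0.
      by move=> /mem_set; rewrite (negbTE xA).
    exact: volume0.
  over.
rewrite -integral_mkcond integral_cst; last exact: mA.
by rewrite EFinM muleC; congr (_ * _)%E; exact: Al.
Qed.

Lemma volume_cell_box (d : nat) (a : R) (m : nat) (c : {ffun 'I_d -> 'I_m.+1}) :
  0 < a -> volume (cell_box a c) = (a ^+ d / (m.+1 ^ d)%:R)%:E.
Proof.
move=> a0; have h0 : 0 < a / m.+1%:R by rewrite divr_gt0.
rewrite (@volume_box d _ (fun=> a / m.+1%:R)).
- by rewrite prodr_const card_ord natrX expr_div_n.
- by move=> j; exact: measurable_itv.
- move=> j; rewrite lebesgue_measure_itv /= lte_fin ltr_pM2r // ltr_nat ltnSn.
  by rewrite -EFinB -mulrBl -natrB // subSnn mul1r.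
Qed.

Lemma volume_torus (d : nat) (a : R) :
  0 < a -> volume (torus a : set (Rd R d)) = (a ^+ d)%:E.
Proof.
move=> a0; rewrite torusE (@volume_box d _ (fun=> a)).
- by rewrite prodr_const card_ord.
- by move=> j; exact: measurable_itv.
- by move=> j; rewrite lebesgue_measure_itv /= lte_fin a0 -EFinB subr0.
Qed.

End volume_box.

(** * Expectations as limits *)

Section integrals.
Context {R : realType} {disp : measure_display} {Omega : measurableType disp}.
Variable P : probability Omega R.

(** Linearity for simple functions. Distinct [f] may give the same [E f], as for a Poisson process,
    where [E f] depends only on the counts of [f]. *)
Lemma integral_finite_partition (F : finType) (A : set Omega) (E : F -> set Omega)
    (h q : F -> R) (X : Omega -> R) :
  measurable A -> (forall f, measurable (E f)) -> (forall f, E f `<=` A) ->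
  (forall f, P (E f) = (q f)%:E) ->
  (forall w, A w -> X w = \sum_f h f * \1_(E f) w) ->
  measurable_fun A X /\ (\int[P]_(w in A) (X w)%:E = (\sum_f h f * q f)%:E)%E.
Proof.
move=> mA mE EA PE XE; have intE f : P.-integrable A (fun w => (\1_(E f) w)%:E).
  by apply: (integrableS measurableT) => //; exact: integrable_indic.
split.
  apply: (eq_measurable_fun (fun w => \sum_f h f * \1_(E f) w)).
    by move=> w /set_mem/XE ->.
  apply: measurable_sum => f; apply: measurable_funM => //.
under eq_integral => w wA.
  rewrite XE; last exact: set_mem.
  rewrite -sumEFin; under eq_bigr do rewrite EFinM.
  over.
rewrite integral_sum //=; last by move=> f; exact: integrableZl.
rewrite -sumEFin; apply: eq_bigr => f _.
rewrite integralZl // integral_indic // EFinM -PE; congr (_ * P _)%E.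
exact: setIidl.
Qed.

(** The limit argument shared by both processes: from the discrete means, let the cells shrink. In
    its uses [p] is the probability of [A]. *)
Lemma integral_cech_euler_limit (d n : nat) (a eps p : R) (A : set Omega)
    (v : Omega -> 'I_n -> Rd R d) :
  (1 <= d)%N -> 0 < a -> 0 < eps -> eps < a / 4%:R -> measurable A ->
  (forall w, A w -> forall i, torus a (v w i)) ->
  (forall m, let Y w := arc_euler (arc_cells a eps m) (cell a m \o v w) : R in
    measurable_fun A Y /\
    (\int[P]_(w in A) (Y w)%:E =
      (p * ((\sum_(f : {ffun 'I_n -> {ffun 'I_d -> 'I_m.+1}})
         arc_euler (arc_cells a eps m) f) / ((m.+1 ^ d) ^ n)%:R))%:E)%E) ->
  let X w := (cech_euler a eps [fset v w i | i in 'I_n]%fset)%:~R : R in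
  P.-integrable A (EFin \o X) /\
  (\int[P]_(w in A) (X w)%:E = (p * \sum_(0 <= k < n.+1)
    (-1) ^+ k.+1 * 'C(n, k)%:R * k%:R ^+ d *
      (2%:R * eps / a) ^ (d%:Z * (k%:Z - 1)))%:E)%E.
Proof.
move=> d1 a0 e0 ea mA va HY X.
pose Y m w : R := arc_euler (arc_cells a eps m) (cell a m \o v w).
have YX w : A w -> Y ^~ w @ \oo --> X w.
  by move=> Aw; apply: cvg_near_cst; apply: near_arc_euler => //; exact: va.
have mX : measurable_fun A X.
  by apply: (@measurable_fun_cvg _ _ _ A Y) => // m; have [] := HY m.
have [iX _ cX] : [/\ P.-integrable A (EFin \o X),
    [sequence \int[P]_(w in A) `|(Y m w)%:E - (X w)%:E|]_m @ \oo --> 0 &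
    [sequence \int[P]_(w in A) (Y m w)%:E]_m @ \oo --> \int[P]_(w in A) (X w)%:E]%E.
  apply: (@dominated_convergence _ _ _ P A mA (fun m => EFin \o Y m) (EFin \o X)
    (EFin \o cst (2 ^ n)%:R)).
  - by move=> m; apply/measurable_EFinP; have [] := HY m.
  - exact/measurable_EFinP.
  - apply: aeW => w Aw; apply: cvg_EFin; first exact: nearW.
    exact: YX.
  - exact: finite_measure_integrable_cst.
  - by apply: aeW => w m _; rewrite /= lee_fin; exact: norm_arc_euler.
split=> //.
apply: (cvg_unique _ cX) => //.
apply: cvg_EFin; first by apply: nearW => m /=; rewrite (HY m).2.
rewrite (_ : fine \o _ = fun m => p * \sum_(0 <= k < n.+1) 'C(n, k)%:R * ((-1)
  ^+ k.+1 *
     (m.+1%:R * ((arc_cells a eps m) ^ k - (arc_cells a eps m).-1 ^ k)%:R /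
       m.+1%:R ^+ k) ^+ d)).
  apply: cvgMl_tmp; apply: cvg_mean_arc_euler => //;
    first by rewrite divr_gt0 // mulr_gt0.
  exact: arc_cells_itv.
apply/funext => m /=; rewrite (HY m).2 /= mean_arc_euler //.
exact: arc_cells_half.
Qed.

(** The events [E f] that each point [i] lies in cell [f i] are equally likely by independence and
    uniformity, and exactly one of them occurs. *)
Lemma iid_integral_arc_euler (d n m L : nat) (a : R)
    (xi : 'I_n -> Omega -> Rd R d) : 0 < a -> iid_uniform P a xi ->
  let Y w := arc_euler L (fun i => cell a m (xi i w)) : R in
  measurable_fun setT Y /\
  (\int[P]_w (Y w)%:E = ((\sum_(f : {ffun 'I_n -> {ffun 'I_d -> 'I_m.+1}})
         arc_euler L f) / ((m.+1 ^ d) ^ n)%:R)%:E)%E.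
Proof.
move=> a0 [xia mxi lxi indep] Y.
pose E (f : {ffun 'I_n -> {ffun 'I_d -> 'I_m.+1}}) := \bigcap_i (xi i @^-1`
  cell_box a (f i)).
rewrite mulr_suml; apply: (integral_finite_partition (E := E)) => //.
- move=> f; apply: fin_bigcap_measurable => // i _.
  by rewrite -[X in measurable X]setTI; apply: mxi => //;
    exact: measurable_cell_box.
- move=> f; rewrite indep => [|i]; last exact: measurable_cell_box.
  rewrite (eq_bigr (fun=> ((m.+1 ^ d)%:R^-1)%:E)) => [|i _].
    by rewrite prodEFin prodr_const card_ord !natrX exprVn.
  rewrite lxi; [|exact: measurable_cell_box|exact: cell_box_torus].
  rewrite volume_cell_box // -EFinM mulrAC mulfV ?mul1r //.
  by rewrite expf_neq0 // gt_eqF.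
move=> w _; pose f0 : {ffun 'I_n -> {ffun 'I_d -> 'I_m.+1}} := [ffun i => cell
  a m (xi i w)].
have Ef f : E f w <-> f = f0.
  split=> [Efw|-> i _]; last by apply/cell_boxP; rewrite ?ffunE.
  by apply/ffunP => i; rewrite ffunE; apply/esym/cell_boxP => //; exact: Efw.
rewrite (bigD1 f0) //= big1 ?addr0 => [|f ff0].
  rewrite indicE mem_set ?mulr1; last exact/Ef.
  by apply: (@arc_euler_perm _ _ _ _ _ _ _ 1%g) => i; rewrite /= perm1 ffunE.
by rewrite indicE memNset ?mulr0 // => /Ef/eqP; rewrite (negbTE ff0).
Qed.

End integrals.

(** * Cell counts of a Poisson process *)

Section poisson_cells.
Context {R : realType}.

Lemma poisson_prob_set1 (r : R) (k i : nat) : 0 < r ->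
  poisson_prob r i [set k] = (poisson_pmf r k)%:E.
Proof. by move=> r0; rewrite /poisson_prob r0 esum_set1 // lee_fin
  poisson_pmf_ge0. Qed.

Lemma poisson_pmf_gt0 (r : R) (k : nat) : 0 < r -> 0 < poisson_pmf r k.
Proof.
move=> r0; rewrite /poisson_pmf r0 !mulr_gt0 ?exprn_gt0 ?expR_gt0 //.
Qed.

(** Independent Poisson counts with a given total are multinomial: the exponentials multiply to that
    of the total, and the factorials yield the number of configurations with counts [m]. *)
Lemma prod_poisson_pmf (C : finType) (n : nat) (m : C -> nat) (r : R) :
  0 < r -> (0 < #|C|)%N -> (\sum_c m c = n)%N ->
  \prod_c poisson_pmf (r / #|C|%:R) (m c) =
  poisson_pmf r n * (#|[pred f : {ffun 'I_n -> C} | [forall c, fibre_size f c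
    == m c]]|%:R
     / (#|C| ^ n)%:R).
Proof.
move=> r0 C0 mn; have C0' : 0 < #|C|%:R :> R by rewrite ltr0n.
have rC : 0 < r / #|C|%:R by rewrite divr_gt0.
set T := #|[pred f : {ffun 'I_n -> C} | _]|;
  have TE : T%:R = n`!%:R / \prod_c (m c)`!%:R :> R.
  rewrite -(card_fibre_size mn) natrM natr_prod mulfK //.
  by rewrite -natr_prod pnatr_eq0 -lt0n; apply: prodn_gt0 => c; exact: fact_gt0.
have nf : n`!%:R != 0 :> R by rewrite pnatr_eq0 -lt0n fact_gt0.
rewrite /poisson_pmf r0 rC !big_split /= prodr_const prodrXr mn prodfV TE.
rewrite -expRM_natl mulrN mulrCA mulfV ?gt_eqF // mulr1 natrX expr_div_n.
have p0 : \prod_c (m c)`!%:R != 0 :> R.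
  by rewrite -natr_prod pnatr_eq0 -lt0n; apply: prodn_gt0 => c; exact: fact_gt0.
have y0 : #|C|%:R ^+ n != 0 :> R by rewrite expf_neq0 // gt_eqF.
move: (n`!%:R) (\prod_c _) (#|C|%:R ^+ n) (r ^+ n) (expR _) nf p0 y0.
by move=> u v x y z u0 v0 x0; field; rewrite u0 v0 x0.
Qed.

End poisson_cells.

Section poisson.
Context {R : realType} {disp : measure_display} {Omega : measurableType disp}.
Variable P : probability Omega R.
Variables (d : nat) (a lambda : R) (omega : Omega -> {fset Rd R d}).
Hypotheses (a_gt0 : 0 < a) (lambda_gt0 : 0 < lambda).
Hypothesis omegaP : poisson_process P a lambda omega.

(** An arbitrary labelling of the points, meaningful when there are [n] of them. Measurability is
    derived from cell counts, which ignore labels. *)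
Definition enum_points (n : nat) (w : Omega) (i : 'I_n) : Rd R d :=
  nth [tuple 0 | _ < d] (enum_fset (omega w)) i.

Lemma enum_points_in (n : nat) (w : Omega) (i : 'I_n) :
  #|` omega w| = n -> enum_points w i \in omega w.
Proof. by move=> wn; apply: mem_nth; rewrite [X in (_ < X)%N]wn. Qed.

Lemma image_enum_points (n : nat) (w : Omega) : #|` omega w| = n ->
  [fset enum_points w i | i in 'I_n]%fset = omega w.
Proof.
move=> wn; apply/fsetP => x; apply/imfsetP/idP => [[i _ ->]|xw].
  exact: enum_points_in.
have xn : (index x (enum_fset (omega w)) < n)%N by rewrite -[X in (_ < X)%N]wn
  index_mem.
by exists (Ordinal xn) => //=; rewrite /enum_points nth_index.
Qed.

Lemma sum_enum_points (n : nat) (w : Omega) (F : Rd R d -> nat) : #|` omega w|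
  = n ->
  (\sum_(x <- omega w) F x = \sum_(i < n) F (enum_points w i))%N.
Proof.
by move=> wn; rewrite (big_nth [tuple 0 | _ < d]) big_mkord -[in RHS]wn.
Qed.

Lemma nb_points_sum (w : Omega) (A : set (Rd R d)) :
  nb_points (omega w) A = (\sum_(x <- omega w) (x \in A))%N.
Proof.
rewrite /nb_points card_fset_sum1 big_fset /= [LHS]big_mkcond /=.
by apply: eq_bigr => x _; case: (x \in A).
Qed.

Lemma nb_points_torus (w : Omega) : nb_points (omega w) (torus a) = #|` omega w|.
Proof.
rewrite nb_points_sum card_fset_sum1 !big_seq; apply: eq_bigr => x xw.
by rewrite mem_set //; exact: (poisson_process_torus omegaP xw).
Qed.

Lemma nb_points_cells (n m : nat) (w : Omega) (c : {ffun 'I_d -> 'I_m.+1}) :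
  #|` omega w| = n ->
  nb_points (omega w) (cell_box a c) =
  fibre_size (fun i : 'I_n => cell a m (enum_points w i)) c.
Proof.
move=> wn; rewrite nb_points_sum (sum_enum_points _ wn); apply: eq_bigr => i _.
have xa := poisson_process_torus omegaP (enum_points_in i wn).
congr nat_of_bool; apply/idP/eqP => [/set_mem/(cell_boxP a_gt0 _ xa) //|H].
by apply: mem_set; apply/cell_boxP.
Qed.

Lemma sum_nb_points_cells (m : nat) (w : Omega) :
  (\sum_(c : {ffun 'I_d -> 'I_m.+1}) nb_points (omega w) (cell_box a c) = #|`
    omega w|)%N.
Proof.
rewrite -[RHS](sum_fibre_size (fun i : 'I_#|` omega w| => cell a m (enum_points
  w i))).
by apply: eq_bigr => c _; exact: nb_points_cells.
Qed.

Lemma measurable_nb_points (A : set (Rd R d)) (k : nat) :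
  measurable A -> A `<=` torus a ->
  measurable [set w | nb_points (omega w) A = k].
Proof.
move=> mA Aa; rewrite -[X in measurable X]setTI.
exact: (poisson_process_measurable omegaP mA Aa measurableT (Y := [set k])).
Qed.

Lemma measurable_card (n : nat) : measurable [set w | #|` omega w| = n].
Proof.
rewrite (_ : mkset _ = [set w | nb_points (omega w) (torus a) = n]).
  by apply: measurable_nb_points => //; exact: measurable_torus.
by apply/seteqP; split => w /=; rewrite nb_points_torus.
Qed.

Lemma prob_card (n : nat) :
  P [set w | #|` omega w| = n] = (poisson_pmf (lambda * a ^+ d) n)%:E.
Proof.
rewrite (_ : mkset _ = [set w | [set n] (nb_points (omega w) (torus a))]).
  rewrite (poisson_process_law omegaP) //; last exact: measurable_torus.
  by rewrite volume_torus // poisson_prob_set1 // mulr_gt0 // exprn_gt0.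
by apply/seteqP; split => w /=; rewrite nb_points_torus.
Qed.

Lemma prob_nb_points_cells (m : nat) (k : {ffun 'I_d -> 'I_m.+1} -> nat) :
  P [set w | forall c, nb_points (omega w) (cell_box a c) = k c] =
  (\prod_c poisson_pmf (lambda * a ^+ d / (m.+1 ^ d)%:R) (k c))%:E.
Proof.
pose C := {ffun 'I_d -> 'I_m.+1}.
have r0 : 0 < lambda * a ^+ d / (m.+1 ^ d)%:R.
  by rewrite divr_gt0 ?mulr_gt0 ?exprn_gt0 // ltr0n expn_gt0.
(* Independence is stated for families indexed by ordinals, hence the enumeration of the cells. *)
have disj : trivIset setT (fun i : 'I_#|{: C}| => cell_box a (enum_val i)).
  move=> i j _ _ [x [xi xj]]; apply: enum_val_inj.
  have xa := cell_box_torus a_gt0 xi.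
  by rewrite -((cell_boxP a_gt0 _ xa).1 xi) ((cell_boxP a_gt0 _ xa).1 xj).
have := poisson_process_independent omegaP
  (fun i => measurable_cell_box a (enum_val i))
  (fun i => @cell_box_torus _ _ _ a_gt0 _ (enum_val i)) disj.
move=> /(_ (fun i => [set k (enum_val i)]) (fun=> I)) indep.
transitivity (P (\bigcap_(i : 'I_#|{: C}|)
    ((fun w => nb_points (omega w) (cell_box a (enum_val i))) @^-1` [set k
      (enum_val i)]))).
  congr (P _); apply/seteqP; split => w wk; first by move=> i _; exact: wk.
  by move=> c; have := wk (enum_rank c) I; rewrite /= enum_rankK.
rewrite indep -prodEFin (reindex_onto enum_rank enum_val) /=; last by move=> i _;
  exact: enum_valK.
apply: eq_big => [c|c _]; first by rewrite enum_rankK eqxx.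
rewrite enum_rankK (poisson_process_law omegaP [set k c]).
- by rewrite volume_cell_box //= mulrA poisson_prob_set1.
- exact: measurable_cell_box.
- exact: cell_box_torus.
Qed.

(** Only events on cell counts enter: [E f] fixes all counts to those of [f], and its probability is
    the share of configurations with these counts times the Poisson mass of [n]. *)
Lemma poisson_integral_arc_euler (n m L : nat) :
  let A := [set w | #|` omega w| = n] in
  let Y w := arc_euler L (fun i : 'I_n => cell a m (enum_points w i)) : R in
  measurable_fun A Y /\
  (\int[P]_(w in A) (Y w)%:E = (poisson_pmf (lambda * a ^+ d) n *
    ((\sum_(f : {ffun 'I_n -> {ffun 'I_d -> 'I_m.+1}}) arc_euler L f)
       / ((m.+1 ^ d) ^ n)%:R))%:E)%E.
Proof.
move=> A Y; pose C := {ffun 'I_d -> 'I_m.+1}.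
pose E (f : {ffun 'I_n -> C}) := [set w | forall c, nb_points (omega w)
  (cell_box a c) = fibre_size f c].
pose T (f : 'I_n -> C) : nat := #|[pred g : {ffun 'I_n -> C} | [forall c,
  fibre_size g c == fibre_size f c]]|.
have T0 (f : {ffun 'I_n -> C}) : (T f)%:R != 0 :> R.
  by rewrite pnatr_eq0 -lt0n; apply/card_gt0P; exists f; rewrite inE; apply/forallP.
have cardC : #|{: C}| = (m.+1 ^ d)%N by rewrite card_ffun !card_ord.
have mE f : measurable (E f).
  rewrite (_ : E f = \bigcap_c [set w | nb_points (omega w) (cell_box a c) =
    fibre_size f c]).
    apply: fin_bigcap_measurable => // c _; apply: measurable_nb_points.
      exact: measurable_cell_box.
    exact: cell_box_torus.
  by apply/seteqP; split => w H c => [_|]; exact: H.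
have EA f : E f `<=` A.
  move=> w Ew; rewrite /A /= -(sum_nb_points_cells m) -[RHS](sum_fibre_size f).
  by apply: eq_bigr => c _; exact: Ew.
pose q f := poisson_pmf (lambda * a ^+ d) n * ((T f)%:R / ((m.+1 ^ d) ^ n)%:R).
have PE (f : {ffun 'I_n -> C}) : P (E f) = (q f)%:E.
  rewrite prob_nb_points_cells; congr EFin.
  have r0 : 0 < lambda * a ^+ d by rewrite mulr_gt0 // exprn_gt0.
  have C0 : (0 < #|{: C}|)%N by rewrite cardC expn_gt0.
  by rewrite /q -cardC (prod_poisson_pmf r0 C0 (sum_fibre_size f)).
(* [arc_euler] depends only on the cell counts: spread its value evenly over
   the [T f] configurations with the same counts as [f]. *)
rewrite (_ : poisson_pmf _ _ * _ = \sum_(f : {ffun 'I_n -> C}) (arc_euler L f /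
  (T f)%:R) * q f); last first.
  rewrite mulr_suml mulr_sumr; apply: eq_bigr => f _; rewrite /q.
  by rewrite [RHS]mulrCA; congr (_ * _); rewrite mulrA divfK.
apply: (integral_finite_partition (E := E)) => //; first exact: measurable_card.
move=> w Aw; pose f0 : {ffun 'I_n -> C} := [ffun i => cell a m (enum_points w i)].
have f0E : f0 =1 (fun i => cell a m (enum_points w i)) by move=> i; rewrite ffunE.
have fs c : fibre_size f0 c = nb_points (omega w) (cell_box a c).
  by rewrite (nb_points_cells _ Aw); apply: eq_bigr => i _; rewrite f0E.
(* Exactly the [T f0] configurations [f] with the counts of [f0] have [w] in [E f], and each
   contributes [Y w / T f0]. *)
transitivity (\sum_(f : {ffun 'I_n -> C} | [forall c, fibre_size f c ==
  fibre_size f0 c])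
    (Y w / (T f0)%:R)).
  by rewrite sumr_const -[RHS]mulr_natr -[#|_|]/(T f0) divfK.
rewrite big_mkcond; apply: eq_bigr => f _; rewrite indicE.
case: ifPn => [/forallP ff0|ff0]; last first.
  rewrite memNset ?mulr0 // => Ew; move/negP: ff0; apply; apply/forallP => c.
  by rewrite fs Ew.
rewrite mem_set ?mulr1; last by move=> c; rewrite -fs (eqP (ff0 c)).
congr (_ / _%:R); last first.
  by apply: eq_card => g; rewrite !inE; apply: eq_forallb => c;
    rewrite (eqP (ff0 c)).
have [s sE] : exists s : 'S_n, f0 =1 f \o s.
  by apply: fibre_size_perm => c; exact/eqP.
by apply: (@arc_euler_perm _ _ _ _ _ _ _ s) => i; rewrite -sE f0E.
Qed.

End poisson.

(** * Conditional and binomial expectations *)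

Theorem corollary12 (R : realType) (d : nat) (a lambda eps : R)
    (disp : measure_display) (Omega : measurableType disp)
    (P : probability Omega R) (n : nat)
    (d_ge1 : (1 <= d)%N) (a_gt0 : 0 < a) (lambda_gt0 : 0 < lambda)
    (eps_gt0 : 0 < eps) (eps_lt : eps < a / 4%:R) :
  let mean : R := \sum_(0 <= k < n.+1)
    (-1) ^+ k.+1 * 'C(n, k)%:R * k%:R ^+ d *
      (2%:R * eps / a) ^ (d%:Z * (k%:Z - 1)) in
  (forall omega : Omega -> {fset Rd R d},
     poisson_process P a lambda omega ->
     P.-integrable [set w | #|` omega w| = n]
       (fun w => ((cech_euler a eps (omega w))%:~R : R)%:E) /\
     cond_expectation P (fun w => (cech_euler a eps (omega w))%:~R)
       [set w | #|` omega w| = n] = mean%:E) /\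
  (forall xi : 'I_n -> Omega -> Rd R d,
     iid_uniform P a xi ->
     P.-integrable setT
       (fun w => ((cech_euler a eps [fset xi i w | i in 'I_n])%:~R : R)%:E) /\
     ('E_P[fun w => (cech_euler a eps [fset xi i w | i in 'I_n])%:~R] = mean%:E)%E).
Proof.
move=> mean; split=> [omega omegaP|xi xiP]; last first.
  case: (@integral_cech_euler_limit R disp Omega P d n a eps 1 setT
    (fun w i => xi i w) d_ge1 a_gt0 eps_gt0 eps_lt measurableT
    (fun w _ i => iid_uniform_torus xiP i w)) => [m|iX IX].
    by rewrite mul1r; exact: iid_integral_arc_euler.
  by split=> //; rewrite unlock IX mul1r.
(* Conditioning divides by this probability, which must not be zero. *)
have pn0 : 0 < poisson_pmf (lambda * a ^+ d) n.
  by apply: poisson_pmf_gt0; rewrite mulr_gt0 // exprn_gt0.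
pose A := [set w | #|` omega w| = n].
have mA : measurable A := measurable_card omegaP n.
case: (@integral_cech_euler_limit R disp Omega P d n a eps
  (poisson_pmf (lambda * a ^+ d) n) A
    (fun w i => enum_points omega w i) d_ge1 a_gt0 eps_gt0 eps_lt mA
    (fun w Aw i => poisson_process_torus omegaP (enum_points_in i Aw))) =>
      [m|iX IX].
  exact: poisson_integral_arc_euler.
have XE w : w \in A ->
   ((cech_euler a eps [fset enum_points omega w i | i in 'I_n]%fset)%:~R)%:E =
   ((cech_euler a eps (omega w))%:~R)%:E :> \bar R.
  by move=> /set_mem Aw; rewrite image_enum_points.
split; first exact: (eq_integrable mA _ _ XE iX).
rewrite /cond_expectation (prob_card a_gt0 lambda_gt0 omegaP) /=.
rewrite (eq_integral _ _ (fun w wA => esym (XE w wA))) IX -EFinM mulrA mulVf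
  ?mul1r //.
by rewrite gt_eqF.
Qed.
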